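(* Let $x_1\le x_2\le\cdots\le x_n$ be integers. Then $$\operatorname{st}_{+}\big(A(x_1,\ldots,x_n)\big)\le 2\left\lceil \log_2(x_n-x_1+1)\right\rceil .$$
   Context: For real numbers $x_1,\ldots,x_n$, the associated Euclidean distance matrix is the $n\times n$ symmetric nonnegative matrix $A(x_1,\ldots,x_n):=\big(|x_i-x_j|^2\big)_{i,j=1}^n$. Here $\mathbb{R}_{+}^{m\times n}$ is the set of $m\times n$ real matrices with nonnegative entries and $\mathcal{S}_n^{+}$ is the set of symmetric $n\times n$ matrices with nonnegative entries. For $A\in\mathcal{S}_n^{+}$, an SN-Trifactorization of $A$ is a factorization $A=BCB^{T}$ with $B\in\mathbb{R}_{+}^{n\times k}$ and $C\in\mathcal{S}_k^{+}$; the SNT-rank $\operatorname{st}_{+}(A)$ is the smallest integer $k$ for which such a factorization exists, with the convention $\operatorname{st}_{+}(0)=0$. *)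

(* Defs.v *)
From mathcomp Require Export all_boot all_order all_algebra.
From mathcomp Require Export boolp classical_sets reals exp.

Set Implicit Arguments.
Unset Strict Implicit.
Unset Printing Implicit Defensive.

Import Order.TTheory GRing.Theory Num.Theory.

Local Open Scope ring_scope.
Local Open Scope classical_set_scope.

Definition edm (R : realType) (n : nat) (x : 'I_n -> R) : 'M[R]_n :=
  \matrix_(i, j) `|x i - x j| ^+ 2.

Definition nonneg_mx (R : realType) (m n : nat) (M : 'M[R]_(m, n)) : Prop :=
  forall i j, 0 <= M i j.

Definition sym_nonneg_mx (R : realType) (n : nat) (M : 'M[R]_n) : Prop :=
  M^T = M /\ nonneg_mx M.

Definition sn_trifact (R : realType) (n : nat) (A : 'M[R]_n) (k : nat) : Prop :=
  exists (B : 'M[R]_(n, k)) (C : 'M[R]_k),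
    [/\ nonneg_mx B, sym_nonneg_mx C & A = B *m C *m B^T].

(* The inner dimension k = 0 is allowed; this yields the usual convention that
   the zero matrix has SNT-rank 0 (lemma snt_rank0). When A is not symmetric
   nonnegative no factorization exists and the value is the dummy 0. *)
Definition snt_rank (R : realType) (n : nat) (A : 'M[R]_n) : nat :=
  xget 0%N [set k | sn_trifact A k /\
                    forall l, sn_trifact A l -> (k <= l)%N].

Definition log2 (R : realType) (t : R) : R := ln t / ln 2.

Lemma snt_rankP (R : realType) (n : nat) (A : 'M[R]_n) :
  sym_nonneg_mx A ->
  sn_trifact A (snt_rank A) /\
  forall l, sn_trifact A l -> (snt_rank A <= l)%N.
Proof.
move=> hA; suff [r hr] : exists r, sn_trifact A r /\
    forall l, sn_trifact A l -> (r <= l)%N.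
  by have /(xgetPex 0%N) : [set k | sn_trifact A k /\
    forall l, sn_trifact A l -> (k <= l)%N] !=set0 by exists r.
have ex : exists k, `[< sn_trifact A k >].
  exists n; apply/asboolP; exists 1%:M, A; split=> //.
    by move=> i j; rewrite mxE ler0n.
  by rewrite trmx1 mul1mx mulmx1.
case: (ex_minnP ex) => r /asboolP hr hmin; exists r; split=> // l hl.
by apply: hmin; apply/asboolP.
Qed.

Lemma snt_rank_le (R : realType) (n : nat) (A : 'M[R]_n) (k : nat) :
  sn_trifact A k -> (snt_rank A <= k)%N.
Proof.
move=> hk; have [B [C [hB [hC1 hC2] eA]]] := hk.
apply: (snt_rankP _).2 => //; split.
  by rewrite eA !trmx_mul trmxK hC1 mulmxA.
move=> i j; rewrite eA mxE; apply: sumr_ge0 => p _; rewrite !mxE.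
by apply: mulr_ge0 => //; apply: sumr_ge0 => q _; apply: mulr_ge0.
Qed.

Lemma snt_rank0 (R : realType) (n : nat) : snt_rank (0 : 'M[R]_n) = 0%N.
Proof.
apply/eqP; rewrite -leqn0; apply: snt_rank_le.
exists 0, 0; split; last by rewrite mulmx0 mul0mx.
  by move=> i j; rewrite mxE.
by split=> [|i j]; rewrite ?trmx0 ?mxE.
Qed.

Lemma edm_sym_nonneg (R : realType) (n : nat) (x : 'I_n -> R) :
  sym_nonneg_mx (edm x).
Proof.
split=> [|i j]; last by rewrite mxE exprn_ge0.
by apply/matrixP => i j; rewrite !mxE distrC.
Qed.

(* Main.v *)
Require Import Defs.
From mathcomp Require Import lra zify.

Import Order.TTheory GRing.Theory Num.Theory.

Local Open Scope ring_scope.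

(** Fold [0, 2^(k+1)) about its midpoint c = (2^(k+1) - 1) / 2. With
    s = |a - c| and t = |b - c|, the value (a - b)^2 is (s - t)^2 if a and b lie
    on the same side of c, and (s - t)^2 + 4 s t otherwise. The matrix of the
    cross terms 4 s t has a factorization of inner dimension 2, and the folded
    points are, up to translation, integers in [0, 2^k). So 2 k dimensions
    suffice for integers in an interval of 2^k points. *)

(** Left factors go side by side and middle factors on a block diagonal, so no cross terms arise. *)
Lemma sn_trifactD {R : realType} {n} {A A' : 'M[R]_n} {k l} :
  sn_trifact A k -> sn_trifact A' l -> sn_trifact (A + A') (k + l).
Proof.
move=> [B [C [B0 [Csym C0] ->]]] [B' [C' [B'0 [C'sym C'0] ->]]].
exists (row_mx B B'), (block_mx C 0 0 C'); split.
- by move=> i j; rewrite mxE; case: split.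
- split; first by rewrite tr_block_mx !trmx0 Csym C'sym.
  by move=> i j; rewrite mxE; case: split => a; rewrite mxE; case: split => b;
    rewrite ?mxE.
- by rewrite mul_row_block !mulmx0 addr0 add0r tr_row_mx mul_row_col.
Qed.

(** The swap matrix as middle factor pairs [u] only with [v], which yields exactly the two mixed
    products. *)
Lemma sn_trifact_sym_outer {R : realType} {n} {u v : 'cV[R]_n} :
  nonneg_mx u -> nonneg_mx v -> sn_trifact (u *m v^T + v *m u^T) 2.
Proof.
move=> u0 v0; rewrite -[2%N]/(1 + 1)%N.
exists (row_mx u v), (block_mx 0 1%:M 1%:M 0); split.
- by move=> i j; rewrite mxE; case: split.
- split; first by rewrite tr_block_mx !trmx0 !trmx1.
  by move=> i j; rewrite mxE; case: split => a; rewrite mxE; case: split => b;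
    rewrite mxE ?ler0n.
- by rewrite mul_row_block !mulmx0 !mulmx1 addr0 add0r tr_row_mx mul_row_col addrC.
Qed.

Lemma sn_trifact_edm_nat {R : realType} {n k} (f : 'I_n -> nat) :
  (forall i, f i < 2 ^ k)%N -> sn_trifact (edm (fun i => (f i)%:R : R)) (2 * k).
Proof.
elim: k f => [|k IHk] f fk.
  exists 0, 0; split; first by move=> i j; rewrite mxE.
    by split=> [|i j]; rewrite ?trmx0 ?mxE.
  apply/matrixP => i j; rewrite mulmx0 mul0mx !mxE.
  have f0 p : f p = 0%N by case: (f p) (fk p).
  by rewrite !f0 subrr normr0 expr0n.
move: IHk fk; rewrite expnS; move: (2 ^ k)%N => N IHk fk.
(* With c = N - 1/2, [g i] is |f i - c| - 1/2: the lower half is reflected, the upper half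
   shifted. *)
pose g i := if (f i < N)%N then (N - 1 - f i)%N else (f i - N)%N.
(* As 2 g + 1 = 2 |f - c|, the entry u_i v_j + v_i u_j is 4 s t across c and 0 on one side of c. *)
pose u : 'cV[R]_n := \col_i if (f i < N)%N then 2 * (g i)%:R + 1 else 0.
pose v : 'cV[R]_n := \col_i if (f i < N)%N then 0 else 2 * (g i)%:R + 1.
have gk i : (g i < N)%N.
  by rewrite /g; case: (ltnP (f i) N) => h; move: (fk i); lia.
have u0 : nonneg_mx u by move=> i j; rewrite mxE; case: ifP; rewrite ?addr_ge0 ?mulr_ge0.
have v0 : nonneg_mx v by move=> i j; rewrite mxE; case: ifP; rewrite ?addr_ge0 ?mulr_ge0.
have fE i : (f i)%:R = (if (f i < N)%N then N%:R - 1 - (g i)%:R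
                        else N%:R + (g i)%:R) :> R.
  rewrite /g; case: ltnP => h; last by rewrite natrB // addrC subrK.
  by rewrite -subnDA natrB ?natrD; [lra | lia].
have -> : edm (fun i => (f i)%:R : R) =
    u *m v^T + v *m u^T + edm (fun i => (g i)%:R : R).
  apply/matrixP => i j; rewrite !mxE !big_ord1 !mxE !real_normK ?num_real //.
  rewrite !fE.
  by case: ifP => _; case: ifP => _; lra.
by rewrite mulnS; apply: sn_trifactD (sn_trifact_sym_outer u0 v0) (IHk _ gk).
Qed.

(** For m >= 1 the logarithm is nonnegative, so its ceiling is a natural number k, and log2 m <= k
    gives m <= 2^k. *)
Lemma le_exp2_ceil_log2 (R : realType) (m : nat) : (0 < m)%N ->
  exists2 k : nat, Num.ceil (log2 (m%:R : R)) = k%:Z & (m <= 2 ^ k)%N.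
Proof.
move=> m0.
have ln2 : 0 < ln (2 : R) by rewrite ln_gt0 // ltr1n.
have log0 : 0 <= log2 (m%:R : R).
  by rewrite divr_ge0 ?(ltW ln2) // ln_ge0 // ler1n.
have ceil0 : 0 <= Num.ceil (log2 (m%:R : R)).
  by rewrite ceil_ge0 (lt_le_trans _ log0) // ltrN10.
exists `|Num.ceil (log2 (m%:R : R))|%N; first by rewrite gez0_abs.
have : log2 (m%:R : R) <= `|Num.ceil (log2 (m%:R : R))|%N%:R.
  by rewrite natr_absz ger0_norm // ceil_ge.
rewrite ler_pdivrMr // mulr_natl -lnXn // ler_ln ?posrE ?ltr0n ?exprn_gt0 //.
by rewrite -natrX ler_nat.
Qed.

Theorem corollary4p2 (R : realType) (n : nat) (x : 'I_n.+1 -> int)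
    (hx : forall i j : 'I_n.+1, (i <= j)%N -> x i <= x j) :
  (snt_rank (edm (fun i : 'I_n.+1 => ((x i)%:~R : R))))%:Z
    <= 2 * Num.ceil (log2 ((x ord_max - x ord0 + 1)%:~R : R)).
Proof.
have x_ge i : x ord0 <= x i by apply: hx.
have x_le i : x i <= x ord_max by apply: hx; rewrite -ltnS.
(* Distances are translation invariant, so the leftmost point may be moved to 0; the points become
   naturals up to [f ord_max]. *)
pose f i := `|(x i - x ord0)%R|%N.
have fE i : x i = x ord0 + (f i)%:Z by rewrite gez0_abs ?subr_ge0 // addrC subrK.
have -> : x ord_max - x ord0 + 1 = (f ord_max).+1%:Z by rewrite (fE ord_max); lia.
have [k -> fk] := le_exp2_ceil_log2 R (f ord_max).+1 isT.
have -> : edm (fun i => (x i)%:~R : R) = edm (fun i => (f i)%:R).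
  by apply/matrixP => i j; rewrite !mxE (fE i) (fE j) !intrD -!pmulrn opprD addrACA subrr add0r.
rewrite -[2]/(2%N%:Z) -PoszM lez_nat.
apply/snt_rank_le/sn_trifact_edm_nat => i; apply: leq_trans fk.
by move: (x_le i); rewrite (fE i) (fE ord_max); lia.
Qed.
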